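(* In the setting described in the context, let $\theta>0$ and $$u_{\mathrm{as},S}(x)=u_0(x)+v(\xi,s)+v^-(\xi^-,s^-)+q(\eta),$$ $$\beta_S(x;p)=u_0(x)+\tilde v(\xi,s;p)+\tilde v^-(\xi^-,s^-;p)+\tilde q(\eta;p)+\theta p,\qquad |p|\le\bar p.$$ Then $\beta_S=u_{\mathrm{as},S}+O(p)$, i.e. $|\beta_S(x;p)-u_{\mathrm{as},S}(x)|\le C|p|$ with $C$ independent of $\varepsilon$, $p$ and $x$. Furthermore, for some sufficiently small $\varepsilon^*>0$, if $0\le p\le\bar p$ and $0<\varepsilon\le\varepsilon^*$, then for all $x\in S$ $$\beta_S(x;-p)\le u_{\mathrm{as},S}(x)-\tfrac12\theta p,\qquad u_{\mathrm{as},S}(x)+\tfrac12\theta p\le\beta_S(x;p).$$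
   Context: Setting. $S\subset\mathbb R^2$ is an open convex sector with vertex $O$ (the origin), opening angle in $(0,\pi)$, and sides (rays) $\Gamma$ and $\Gamma^-$. Let $b(x,u)$ be smooth, let $g$ on $\partial S$ be smooth on each of $\Gamma,\Gamma^-$ and continuous at $O$ (write $g^-$ for $g|_{\Gamma^-}$), and let $u_0$ be a smooth function with $b(x,u_0(x))=0$ for $x\in\bar S$. The functions $u_0$, $g$, $b(\cdot,t)$ and their derivatives are bounded as $|x|\to\infty$ (for $b$ uniformly for $t$ in compact sets). Assume: (A1) there is $\gamma>0$ with $b_u(x,u_0(x))>\gamma^2$ for all $x\in S$; (A2) $\int_{u_0(x)}^{w}b(x,t)\,dt>0$ for all $w\in(u_0(x),g(x)]$, $x\in\partial S$; (A3) $b(O,g(O))>0$; (A4) $u_0(x)<g(x)$ for all $x\in\partial S$. Define $B(x,t)=b(x,u_0(x)+t)$ and $\tilde B(x,t;p)=B(x,t)-p\,t$; $B_t$ and $\nabla_xB$ denote derivatives with respect to the second and first argument. Coordinates. Let $\mathbf e_s$ be the unit vector in the direction of $\Gamma$ and $\mathbf e_r$ the unit vector orthogonal to it pointing into $S$; similarly $\mathbf e_{s^-},\mathbf e_{r^-}$ for $\Gamma^-$. Write $x=s\mathbf e_s+r\mathbf e_r=s^-\mathbf e_{s^-}+r^-\mathbf e_{r^-}$, $\bar x=s\mathbf e_s$, and $\eta=x/\varepsilon$, $\xi=r/\varepsilon$, $\sigma=s/\varepsilon$, $\xi^-=r^-/\varepsilon$, $\sigma^-=s^-/\varepsilon$.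 Boundary layer functions. The functions $u_0$, $b$ are extended smoothly to $\mathbb R^2$ and $\mathbb R^2\times\mathbb R$ so that $b(x,u_0(x))=0$, A1 and the boundedness assumptions hold on $\mathbb R^2$, and $g|_\Gamma$ is extended smoothly to the line through $\Gamma$ so that A2, A4 hold on it. For $s\in\mathbb R$ and small $|p|$, $\tilde v_0(\xi,s;p)$ solves $$-\partial_\xi^2\tilde v_0+\tilde B(\bar x,\tilde v_0;p)=0\ (\xi>0),\quad \tilde v_0(0,s;p)=g(\bar x)-u_0(\bar x),\quad \tilde v_0(\infty,s;p)=0,$$ $v_0=\tilde v_0|_{p=0}$, and $v_1(\xi,s)$ solves $$-\partial_\xi^2v_1+v_1B_t(\bar x,v_0)=-\xi\,\mathbf e_r\cdot\nabla_xB(\bar x,v_0),\quad v_1(0,s)=v_1(\infty,s)=0.$$ Set $\tilde v=\tilde v_0+\varepsilon v_1$, $v=v_0+\varepsilon v_1$. The functions $\tilde v_0^-,v_0^-,v_1^-,\tilde v^-,v^-$ of $(\xi^-,s^-)$ are defined analogously for $\Gamma^-$. A small circle means evaluation at $s=0$ (resp. $s^-=0$): $\mathring{\tilde v}_0(\xi;p)=\tilde v_0(\xi,0;p)$, $\mathring v_0(\xi)=v_0(\xi,0)$, $\mathring v_1(\xi)=v_1(\xi,0)$, $\mathring v_{0,s}(\xi)=\partial_sv_0(\xi,s)|_{s=0}$, and similarly with superscript $-$. Corner layer functions. $\tilde z_0(\eta;p)$ is a bounded solution of $$-\Delta_\eta\tilde z_0+\tilde B(O,\tilde z_0;p)=0\text{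 in }S,\qquad \tilde z_0=g(O)-u_0(O)\text{ on }\partial S,$$ $z_0=\tilde z_0|_{p=0}$, $z_1(\eta)$ is a solution of $$-\Delta_\eta z_1+z_1B_t(O,z_0)=-\eta\cdot\nabla_xB(O,z_0)\text{ in }S,$$ $$z_1=\sigma\,\partial_s(g-u_0)|_{x=O}\text{ on }\Gamma,\qquad z_1=\sigma^-\,\partial_{s^-}(g^--u_0)|_{x=O}\text{ on }\Gamma^-,$$ and $$\tilde q_0=\tilde z_0-\mathring{\tilde v}_0(\xi;p)-\mathring{\tilde v}{}_0^-(\xi^-;p),\quad q_1=z_1-[\mathring v_1(\xi)+\sigma\mathring v_{0,s}(\xi)]-[\mathring v_1^-(\xi^-)+\sigma^-\mathring v^-_{0,s^-}(\xi^-)],$$ $\tilde q=\tilde q_0+\varepsilon q_1$, $q_0=\tilde q_0|_{p=0}$, $q=q_0+\varepsilon q_1$. Known facts (may be used; the functions are taken to have these properties). There is a sufficiently small $\bar p\in(0,\gamma^2)$ such that all these functions exist for $|p|\le\bar p$, and: $\tilde v_0\ge0$, $\partial_p\tilde v_0\ge0$, and for every $k\ge0$ and fixed small $\delta>0$ there is $C$ with $$|\partial_\xi^k\tilde v_0|+|\partial_s^k\tilde v_0|+|\partial_\xi^kv_1|+|\partial_s^kv_1|+|\partial_p\tilde v_0|+|\partial_p\partial_s\tilde v_0|\le Ce^{-(\gamma-\sqrt{|p|}-\delta)\xi}\quad(\xi\ge0,\ s\in\mathbb R),$$ and similarly for $\Gamma^-$; $\tilde z_0$ is increasing in $p$ and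 $0<\max\{\mathring{\tilde v}_0,\mathring{\tilde v}{}_0^-\}\le\tilde z_0\le g(O)-u_0(O)$ in $S$; and $|\tilde q_0|+|q_1|+|\partial_p\tilde q_0|\le C_1e^{-c_1|\eta|}$ in $S$ with constants $C_1,c_1>0$ independent of $p$. *)

(* Defs.v *)
From Stdlib Require Export Reals List.
From Coquelicot Require Export Coquelicot.
Export ListNotations.
Open Scope R_scope.

Notation plane := (prod_NormedModule R_AbsRing R_NormedModule R_NormedModule).
Notation space := (prod_NormedModule R_AbsRing plane R_NormedModule).

Definition origin : plane := (0, 0).
Definition dot (x y : plane) : R := fst x * fst y + snd x * snd y.

(* Derivatives relative to a set D: the definition of [is_derive] with the
   filter [locally x] restricted to D; one-sided at an end point of D. *)
Definition is_derive_on (D : R -> Prop) (f : R -> R) (x l : R) : Prop :=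
  filterdiff f (within D (locally x)) (fun y : R => scal y l).
Definition ex_derive_on (D : R -> Prop) (f : R -> R) (x : R) : Prop :=
  exists l, is_derive_on D f x l.
Definition Derive_on (D : R -> Prop) (f : R -> R) (x : R) : R :=
  iota (fun l : R => is_derive_on D f x l).

Fixpoint Derive_n_on (D : R -> Prop) (f : R -> R) (n : nat) (x : R) : R :=
  match n with
  | O => f x
  | S k => Derive_on D (Derive_n_on D f k) x
  end.
Definition ex_derive_n_on (D : R -> Prop) (f : R -> R) (n : nat) (x : R)
  : Prop :=
  match n with
  | O => True
  | S k => ex_derive_on D (Derive_n_on D f k) x
  end.

Definition halfline (xi : R) : Prop := 0 <= xi.

Definition dir_derive {V : NormedModule R_AbsRing} (v : V) (f : V -> R) (x : V)
  : R := Derive (fun t : R => f (plus x (scal t v))) 0.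
Fixpoint dir_derives {V : NormedModule R_AbsRing} (l : list V) (f : V -> R)
  : V -> R :=
  match l with
  | [] => f
  | v :: l' => dir_derive v (dir_derives l' f)
  end.

(* C^k for open D, through iterated derivatives in arbitrary directions. *)
Definition Ck_on {V : NormedModule R_AbsRing} (k : nat) (D : V -> Prop)
  (f : V -> R) : Prop :=
  forall (l : list V) (x : V), D x ->
    ((length l <= k)%nat -> continuous (dir_derives l f) x) /\
    ((length l < k)%nat -> forall v : V,
       ex_derive (fun t : R => dir_derives l f (plus x (scal t v))) 0).
Definition smooth {V : NormedModule R_AbsRing} (f : V -> R) : Prop :=
  forall k, Ck_on k (fun _ => True) f.

Definition grad (f : plane -> R) (x : plane) : plane :=
  (dir_derive ((1, 0) : plane) f x, dir_derive ((0, 1) : plane) f x).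
Definition laplacian (f : plane -> R) (x : plane) : R :=
  dir_derives [((1, 0) : plane); ((1, 0) : plane)] f x +
  dir_derives [((0, 1) : plane); ((0, 1) : plane)] f x.

(* One side of the sector: the unit vectors along it and normal to it, and the
   boundary datum on the line through it, as a function of arc length. *)
Record side := Side { e_s : plane; e_r : plane; g_s : R -> R }.

Definition on_side (G : side) (sigma : R) : plane := scal sigma (e_s G).

Definition sector (G Gm : side) (x : plane) : Prop :=
  exists a c, 0 < a /\ 0 < c /\ x = plus (on_side G a) (on_side Gm c).
Definition closed_sector (G Gm : side) (x : plane) : Prop :=
  exists a c, 0 <= a /\ 0 <= c /\ x = plus (on_side G a) (on_side Gm c).

Record is_frame (G Gm : side) : Prop := {
  frame_s : norm (e_s G) = 1;
  frame_r : norm (e_r G) = 1;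
  frame_orth : dot (e_r G) (e_s G) = 0;
  frame_in : forall x, sector G Gm x -> 0 < dot x (e_r G)
}.

Record is_sector (G Gm : side) : Prop := {
  sector_frame : is_frame G Gm;
  sector_frame_m : is_frame Gm G;
  sector_angle : 0 < acos (dot (e_s G) (e_s Gm)) < PI
}.

(* The datum on one side. [g_s G] is the extension of the restriction of g to
   the closed side; the smoothness of g on the side is that of [g_s G]. *)
Record side_data (b : plane -> R -> R) (u0 g : plane -> R) (G : side)
  : Prop := {
  side_ext : forall s, 0 <= s -> g_s G s = g (on_side G s);
  side_smooth : forall k s, ex_derive_n (g_s G) k s;
  side_bounded : forall k, exists M, forall s, 0 <= s ->
    Rabs (Derive_n (g_s G) k s) <= M;
  side_A2 : forall s w, u0 (on_side G s) < w <= g_s G s ->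
    0 < RInt (b (on_side G s)) (u0 (on_side G s)) w;
  side_A4 : forall s, u0 (on_side G s) < g_s G s
}.

(* Here b and u0 are already extended to the whole space. A smooth function on
   the plane is bounded as |x| -> oo iff it is bounded. *)
Record problem_data (b : plane -> R -> R) (u0 g : plane -> R) (gamma : R)
  (G Gm : side) : Prop := {
  b_smooth : smooth (fun y : space => b (fst y) (snd y));
  b_bounded : forall (l : list plane) (K : R), exists M,
    forall (x : plane) (t : R), Rabs t <= K ->
      Rabs (dir_derives l (fun y => b y t) x) <= M;
  u0_smooth : smooth u0;
  u0_bounded : forall l : list plane, exists M, forall x,
    Rabs (dir_derives l u0 x) <= M;
  u0_root : forall x, b x (u0 x) = 0;
  A1_gamma : 0 < gamma;
  A1 : forall x, gamma ^ 2 < Derive (b x) (u0 x);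
  A3 : 0 < b origin (g origin);
  data_side : side_data b u0 g G;
  data_side_m : side_data b u0 g Gm
}.

Definition B (b : plane -> R -> R) (u0 : plane -> R) (x : plane) (t : R) : R :=
  b x (u0 x + t).
Definition Bp (b : plane -> R -> R) (u0 : plane -> R) (p : R) (x : plane)
  (t : R) : R := B b u0 x t - p * t.
Definition B_t (b : plane -> R -> R) (u0 : plane -> R) (x : plane) (t : R) : R :=
  Derive (B b u0 x) t.
Definition grad_B (b : plane -> R -> R) (u0 : plane -> R) (x : plane) (t : R)
  : plane := grad (fun y => B b u0 y t) x.

(* [v0t xi s p] is tilde v_0(xi, s; p); [v1 xi s] is v_1(xi, s).
   Only xi >= 0 and |p| <= pbar are meaningful. *)
Record layer := Layer { v0t : R -> R -> R -> R; v1 : R -> R -> R }.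

Definition v0 (L : layer) (xi s : R) : R := v0t L xi s 0.
Definition v0_s (L : layer) (xi : R) : R := Derive (v0 L xi) 0.
Definition vt (L : layer) (eps xi s p : R) : R := v0t L xi s p + eps * v1 L xi s.
Definition v (L : layer) (eps xi s : R) : R := v0 L xi s + eps * v1 L xi s.

Definition small (pbar p : R) : Prop := Rabs p <= pbar.

Record layer_problem (b : plane -> R -> R) (u0 : plane -> R) (pbar : R)
  (G : side) (L : layer) : Prop := {
  v0t_eq : forall s p xi, small pbar p -> 0 < xi ->
    - Derive_n_on halfline (fun y => v0t L y s p) 2 xi
    + Bp b u0 p (on_side G s) (v0t L xi s p) = 0;
  v0t_0 : forall s p, small pbar p ->
    v0t L 0 s p = g_s G s - u0 (on_side G s);
  v0t_lim : forall s p, small pbar p ->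
    is_lim (fun xi => v0t L xi s p) p_infty 0;
  v1_eq : forall s xi, 0 < xi ->
    - Derive_n_on halfline (fun y => v1 L y s) 2 xi
    + v1 L xi s * B_t b u0 (on_side G s) (v0 L xi s)
    = - xi * dot (e_r G) (grad_B b u0 (on_side G s) (v0 L xi s));
  v1_0 : forall s, v1 L 0 s = 0;
  v1_lim : forall s, is_lim (fun xi => v1 L xi s) p_infty 0
}.

(* In [layer_decay] the bound gets weaker as delta grows, so that requiring it
   for all delta > 0 is requiring it for all small delta > 0. *)
Record layer_facts (gamma pbar : R) (L : layer) : Prop := {
  layer_ex : forall (k : nat) (s p xi : R), small pbar p -> 0 <= xi ->
    ex_derive_n_on halfline (fun y => v0t L y s p) k xi /\
    ex_derive_n (fun y => v0t L xi y p) k s /\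
    ex_derive_n_on halfline (fun y => v1 L y s) k xi /\
    ex_derive_n (v1 L xi) k s /\
    ex_derive_on (small pbar) (v0t L xi s) p /\
    ex_derive_on (small pbar) (fun p' => Derive (fun y => v0t L xi y p') s) p;
  layer_nonneg : forall s p xi, small pbar p -> 0 <= xi -> 0 <= v0t L xi s p;
  layer_p_nonneg : forall s p xi, small pbar p -> 0 <= xi ->
    0 <= Derive_on (small pbar) (v0t L xi s) p;
  layer_decay : forall (k : nat) (delta : R), 0 < delta -> exists C,
    forall s p xi, small pbar p -> 0 <= xi ->
      Rabs (Derive_n_on halfline (fun y => v0t L y s p) k xi)
      + Rabs (Derive_n (fun y => v0t L xi y p) k s)
      + Rabs (Derive_n_on halfline (fun y => v1 L y s) k xi)
      + Rabs (Derive_n (v1 L xi) k s)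
      + Rabs (Derive_on (small pbar) (v0t L xi s) p)
      + Rabs (Derive_on (small pbar)
                (fun p' => Derive (fun y => v0t L xi y p') s) p)
      <= C * exp (- (gamma - sqrt (Rabs p) - delta) * xi)
}.

(* [z0t eta p] is tilde z_0(eta; p), [z1 eta] is z_1(eta), for eta in the
   closed sector. *)
Record corner := Corner { z0t : plane -> R -> R; z1 : plane -> R }.

(* The derivative along the side, at the vertex, of g - u0. *)
Definition slope (u0 : plane -> R) (G : side) : R :=
  Derive (fun s => g_s G s - u0 (on_side G s)) 0.

(* Solutions are classical: C^2 in S and continuous up to the boundary. *)
Record corner_problem (b : plane -> R -> R) (u0 g : plane -> R) (pbar : R)
  (G Gm : side) (Z : corner) : Prop := {
  z0t_C2 : forall p, small pbar p ->
    Ck_on 2 (sector G Gm) (fun eta => z0t Z eta p);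
  z0t_cont : forall p, small pbar p ->
    continuous_on (closed_sector G Gm) (fun eta => z0t Z eta p);
  z0t_bounded : forall p, small pbar p -> exists M, forall eta,
    sector G Gm eta -> Rabs (z0t Z eta p) <= M;
  z0t_eq : forall p eta, small pbar p -> sector G Gm eta ->
    - laplacian (fun y => z0t Z y p) eta + Bp b u0 p origin (z0t Z eta p) = 0;
  z0t_bd : forall p sigma, small pbar p -> 0 <= sigma ->
    z0t Z (on_side G sigma) p = g origin - u0 origin /\
    z0t Z (on_side Gm sigma) p = g origin - u0 origin;
  z1_C2 : Ck_on 2 (sector G Gm) (z1 Z);
  z1_cont : continuous_on (closed_sector G Gm) (z1 Z);
  z1_eq : forall eta, sector G Gm eta ->
    - laplacian (z1 Z) eta + z1 Z eta * B_t b u0 origin (z0t Z eta 0)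
    = - dot eta (grad_B b u0 origin (z0t Z eta 0));
  z1_bd : forall sigma, 0 <= sigma ->
    z1 Z (on_side G sigma) = sigma * slope u0 G /\
    z1 Z (on_side Gm sigma) = sigma * slope u0 Gm
}.

Definition q0t (G Gm : side) (L Lm : layer) (Z : corner) (eta : plane) (p : R)
  : R :=
  z0t Z eta p - v0t L (dot eta (e_r G)) 0 p - v0t Lm (dot eta (e_r Gm)) 0 p.

(* mathring v_1(xi) + sigma mathring v_{0,s}(xi) *)
Definition v1_corner (L : layer) (xi sigma : R) : R :=
  v1 L xi 0 + sigma * v0_s L xi.

Definition q1 (G Gm : side) (L Lm : layer) (Z : corner) (eta : plane) : R :=
  z1 Z eta
  - v1_corner L (dot eta (e_r G)) (dot eta (e_s G))
  - v1_corner Lm (dot eta (e_r Gm)) (dot eta (e_s Gm)).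

Definition qt (G Gm : side) (L Lm : layer) (Z : corner) (eps : R) (eta : plane)
  (p : R) : R := q0t G Gm L Lm Z eta p + eps * q1 G Gm L Lm Z eta.
Definition q (G Gm : side) (L Lm : layer) (Z : corner) (eps : R) (eta : plane)
  : R := q0t G Gm L Lm Z eta 0 + eps * q1 G Gm L Lm Z eta.

Record corner_facts (u0 g : plane -> R) (pbar : R) (G Gm : side)
  (L Lm : layer) (Z : corner) : Prop := {
  z0t_incr : forall eta p p', sector G Gm eta ->
    small pbar p -> small pbar p' -> p <= p' -> z0t Z eta p <= z0t Z eta p';
  z0t_bounds : forall eta p, sector G Gm eta -> small pbar p ->
    let m :=
      Rmax (v0t L (dot eta (e_r G)) 0 p) (v0t Lm (dot eta (e_r Gm)) 0 p) in
    0 < m /\ m <= z0t Z eta p <= g origin - u0 origin;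
  q0t_ex : forall eta p, sector G Gm eta -> small pbar p ->
    ex_derive_on (small pbar) (q0t G Gm L Lm Z eta) p;
  q_decay : exists C1 c1, 0 < C1 /\ 0 < c1 /\
    forall eta p, sector G Gm eta -> small pbar p ->
      Rabs (q0t G Gm L Lm Z eta p) + Rabs (q1 G Gm L Lm Z eta)
      + Rabs (Derive_on (small pbar) (q0t G Gm L Lm Z eta) p)
      <= C1 * exp (- c1 * norm eta)
}.

Definition u_as (u0 : plane -> R) (G Gm : side) (L Lm : layer) (Z : corner)
  (eps : R) (x : plane) : R :=
  u0 x
  + v L eps (dot x (e_r G) / eps) (dot x (e_s G))
  + v Lm eps (dot x (e_r Gm) / eps) (dot x (e_s Gm))
  + q G Gm L Lm Z eps (scal (/ eps) x).

Definition beta (u0 : plane -> R) (G Gm : side) (L Lm : layer) (Z : corner)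
  (theta eps : R) (x : plane) (p : R) : R :=
  u0 x
  + vt L eps (dot x (e_r G) / eps) (dot x (e_s G)) p
  + vt Lm eps (dot x (e_r Gm) / eps) (dot x (e_s Gm)) p
  + qt G Gm L Lm Z eps (scal (/ eps) x) p
  + theta * p.

(* Main.v *)
Require Import Defs.
From Stdlib Require Import Lra.

(** The first-order terms [eps * v1] and [eps * q1] do not depend on [p], so
    they cancel in differences of [beta] in [p], and [beta] at [p = 0] is
    [u_as].  Both claims are therefore statements about the map
    [p |-> beta x p] on the interval [|p| <= pbar]: it is Lipschitz, and for
    small [eps] it increases with slope at least [theta / 2].

    The Lipschitz bound is the mean value theorem in [p]: as
    [sqrt |p| <= sqrt pbar < gamma], the exponents in the decay estimates are
    negative, so the [p]-derivatives of [v0t] and [q0t] are bounded uniformly.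

    For the slope, the term [theta * p] has to absorb half of itself against a
    possible decrease of [q0t], whose monotonicity in [p] is not known.  Two
    arguments cover the sector, separated by a radius [K] in the stretched
    variable [eta = x / eps].
    - Far from the vertex, [|eta| >= K]: the layer functions [v0t] are
      nondecreasing in [p], and the [p]-derivative of [q0t], at most
      [C1 * exp (- c1 * |eta|)], is below [theta / 2].
    - Near the vertex, [|eta| <= K]: writing [q0t] through [z0t], which is
      nondecreasing in [p], leaves the increments of
      [v0t xi s p - v0t xi 0 p].  By the mean value theorem in [p] and then
      in [s] these are at most a constant times [|s|] times the increment of
      [p], and [|s| <= eps * K] makes that small.
    The two cases are [layer_mixed_lipschitz] with [corner_near_vertex], and
    [layer_increasing] with [corner_far_from_vertex]; they are combined in
    [beta_increase]. *)

(** * Calculus on the closed interval of parameters *)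

Lemma is_derive_on_bound (D : R -> Prop) (f : R -> R) (x l : R) :
  is_derive_on D f x l -> forall e, 0 < e -> exists d, 0 < d /\
  forall y, D y -> Rabs (y - x) < d ->
    Rabs (f y - f x - (y - x) * l) <= e * Rabs (y - x).
Proof.
intros [_ Hd] e He.
assert (Hlim : is_filter_lim (within D (locally x)) x).
{ intros P HP. unfold within. revert HP. apply filter_imp. auto. }
destruct (Hd x Hlim (mkposreal e He)) as [d Hd'].
exists d. split; [apply cond_pos|].
intros y Dy Hy. exact (Hd' y Hy Dy).
Qed.

Lemma small_approach (a p d : R) :
  0 < a -> small a p -> 0 < d ->
  exists y, small a y /\ 0 < Rabs (y - p) < d.
Proof.
unfold small. intros Ha Hp Hd.
set (t := Rmin a (d / 2)).
assert (Ht : 0 < t <= a /\ t < d).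
{ unfold t. generalize (Rmin_l a (d / 2)) (Rmin_r a (d / 2)).
  intros. split; [split|]; try lra. apply Rmin_glb_lt; lra. }
apply Rabs_le_between in Hp.
destruct (Rle_dec p 0) as [H|H].
- exists (p + t). replace (p + t - p) with t by ring.
  rewrite (Rabs_pos_eq t) by lra. split; [apply Rabs_le|]; lra.
- exists (p - t). replace (p - t - p) with (- t) by ring.
  rewrite Rabs_Ropp, (Rabs_pos_eq t) by lra. split; [apply Rabs_le|]; lra.
Qed.

(** A derivative relative to an interval is unique because no point of the
    interval is isolated in it. *)
Lemma is_derive_on_small_unique (a : R) (f : R -> R) (p l l' : R) :
  0 < a -> small a p ->
  is_derive_on (small a) f p l -> is_derive_on (small a) f p l' -> l = l'.
Proof.
intros Ha Hp H H'.
destruct (Req_dec l l') as [E|N]; [exact E|exfalso].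
assert (He : 0 < Rabs (l - l') / 4).
{ assert (0 < Rabs (l - l')) by (apply Rabs_pos_lt; lra). lra. }
destruct (is_derive_on_bound _ _ _ _ H _ He) as [d [Hd Bd]].
destruct (is_derive_on_bound _ _ _ _ H' _ He) as [d' [Hd' Bd']].
destruct (small_approach a p (Rmin d d') Ha Hp) as [y [Dy [Hy0 Hy]]].
{ apply Rmin_glb_lt; lra. }
generalize (Rmin_l d d') (Rmin_r d d'); intros.
specialize (Bd y Dy ltac:(lra)). specialize (Bd' y Dy ltac:(lra)).
assert (T : Rabs ((y - p) * (l - l'))
  <= Rabs (f y - f p - (y - p) * l') + Rabs (f y - f p - (y - p) * l)).
{ replace ((y - p) * (l - l')) with
    ((f y - f p - (y - p) * l') + - (f y - f p - (y - p) * l)) by ring.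
  eapply Rle_trans; [apply Rabs_triang|]. rewrite Rabs_Ropp. lra. }
rewrite Rabs_mult in T. nra.
Qed.

Lemma Derive_on_small_correct (a : R) (f : R -> R) (p : R) :
  0 < a -> small a p -> ex_derive_on (small a) f p ->
  is_derive_on (small a) f p (Derive_on (small a) f p).
Proof.
intros Ha Hp [l Hl].
apply (iota_correct (fun l : R => is_derive_on (small a) f p l)).
exists l. split; [exact Hl|].
intros l' Hl'. exact (is_derive_on_small_unique a f p l l' Ha Hp Hl Hl').
Qed.

Definition clamp (a x : R) : R := Rmax (- a) (Rmin a x).

Lemma clamp_small (a x : R) : 0 < a -> small a (clamp a x).
Proof.
intros Ha. unfold clamp, small, Rmax, Rmin.
apply Rabs_le. repeat destruct Rle_dec; lra.
Qed.

Lemma clamp_id (a x : R) : small a x -> clamp a x = x.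
Proof.
intros Hx. apply Rabs_le_between in Hx.
unfold clamp. rewrite Rmin_right, Rmax_right; lra.
Qed.

Lemma clamp_contract (a x y : R) :
  0 < a -> Rabs (clamp a y - clamp a x) <= Rabs (y - x).
Proof.
intros Ha. unfold clamp, Rmax, Rmin.
repeat destruct Rle_dec; unfold Rabs; repeat destruct Rcase_abs; lra.
Qed.

(** The mean value theorem for derivatives that are one-sided at the ends of
    the interval.  The usual theorem wants two-sided continuity at the end
    points, so it is applied to [f] composed with the projection onto the
    interval. *)
Lemma MVT_small (a : R) (f : R -> R) :
  0 < a -> (forall p, small a p -> ex_derive_on (small a) f p) ->
  forall p p', small a p -> small a p' ->
  exists c, small a c /\ f p' - f p = Derive_on (small a) f c * (p' - p).
Proof.
intros Ha Hex p p' Hp Hp'.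
set (h := fun x => f (clamp a x)).
assert (Hb : forall c, Rmin p p' <= c <= Rmax p p' -> small a c).
{ intros c Hc. apply Rabs_le. apply Rabs_le_between in Hp, Hp'.
  unfold Rmin, Rmax in Hc. destruct Rle_dec; lra. }
destruct (MVT_gen h p p' (Derive_on (small a) f)) as [c [Hc E]].
- intros x Hx.
  assert (Sx : - a < x < a).
  { apply Rabs_le_between in Hp, Hp'.
    unfold Rmin, Rmax in Hx. destruct Rle_dec; lra. }
  assert (Sx' : small a x) by (apply Rabs_le; lra).
  apply is_derive_Reals. intros e He.
  destruct (is_derive_on_bound _ _ _ _
    (Derive_on_small_correct a f x Ha Sx' (Hex x Sx')) (e / 2) ltac:(lra))
    as [d [Hd Bd]].
  assert (Hm : 0 < Rmin d (Rmin (a - x) (x + a))).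
  { repeat apply Rmin_glb_lt; lra. }
  exists (mkposreal _ Hm). simpl. intros t Ht0 Ht.
  generalize (Rmin_l d (Rmin (a - x) (x + a)))
    (Rmin_r d (Rmin (a - x) (x + a)))
    (Rmin_l (a - x) (x + a)) (Rmin_r (a - x) (x + a)); intros.
  assert (Dt : small a (x + t)).
  { assert (Ht' : Rabs t <= Rmin (a - x) (x + a)) by lra.
    apply Rabs_le_between in Ht'. apply Rabs_le. lra. }
  unfold h. rewrite !clamp_id by assumption.
  specialize (Bd (x + t) Dt). replace (x + t - x) with t in Bd by ring.
  specialize (Bd ltac:(lra)).
  replace ((f (x + t) - f x) / t - Derive_on (small a) f x)
    with ((f (x + t) - f x - t * Derive_on (small a) f x) / t)
    by (field; exact Ht0).
  unfold Rdiv. rewrite Rabs_mult, Rabs_inv.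
  assert (Pt : 0 < Rabs t) by (apply Rabs_pos_lt; exact Ht0).
  apply (Rle_lt_trans _ (e / 2 * Rabs t * / Rabs t)).
  + apply Rmult_le_compat_r; [|exact Bd].
    left. apply Rinv_0_lt_compat. exact Pt.
  + replace (e / 2 * Rabs t * / Rabs t) with (e / 2) by (field; lra). lra.
- intros x Hx. specialize (Hb x Hx).
  set (l := Derive_on (small a) f x).
  destruct (is_derive_on_bound _ _ _ _
    (Derive_on_small_correct a f x Ha Hb (Hex x Hb)) 1 ltac:(lra))
    as [d [Hd Bd]]. fold l in Bd.
  intros e He.
  assert (Pl : 0 < 2 + Rabs l) by (generalize (Rabs_pos l); lra).
  exists (Rmin d (e / (2 + Rabs l))). split.
  { apply Rmin_glb_lt; [lra|]. apply Rdiv_lt_0_compat; lra. }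
  intros y [_ Hy]. simpl in Hy |- *. unfold Rdist in *.
  generalize (Rmin_l d (e / (2 + Rabs l)))
    (Rmin_r d (e / (2 + Rabs l))); intros.
  unfold h. rewrite (clamp_id a x Hb).
  generalize (clamp_contract a x y Ha). rewrite (clamp_id a x Hb). intros Hcl.
  specialize (Bd (clamp a y) (clamp_small a y Ha) ltac:(lra)).
  set (w := clamp a y) in *.
  assert (T : Rabs (f w - f x) <= (1 + Rabs l) * Rabs (w - x)).
  { replace (f w - f x)
      with ((f w - f x - (w - x) * l) + (w - x) * l) by ring.
    eapply Rle_trans; [apply Rabs_triang|]. rewrite (Rabs_mult (w - x) l).
    lra. }
  assert (Hy' : Rabs (w - x) < e / (2 + Rabs l)) by lra.
  apply (Rmult_lt_compat_l (2 + Rabs l)) in Hy'; [|exact Pl].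
  replace ((2 + Rabs l) * (e / (2 + Rabs l))) with e in Hy' by (field; lra).
  generalize (Rabs_pos (w - x)). nra.
- exists c. split; [exact (Hb c Hc)|].
  unfold h in E. rewrite !clamp_id in E by assumption. exact E.
Qed.

Lemma lipschitz_small (a M : R) (f : R -> R) :
  0 < a -> (forall p, small a p -> ex_derive_on (small a) f p) ->
  (forall p, small a p -> Rabs (Derive_on (small a) f p) <= M) ->
  forall p p', small a p -> small a p' ->
  Rabs (f p' - f p) <= M * Rabs (p' - p).
Proof.
intros Ha Hex HM p p' Hp Hp'.
destruct (MVT_small a f Ha Hex p p' Hp Hp') as [c [Hc ->]].
rewrite Rabs_mult. apply Rmult_le_compat_r; [apply Rabs_pos|auto].
Qed.

(** * Boundary layer functions as functions of the parameter *)

(** The rate [gamma - sqrt |p| - delta] stays positive for all admissible [p]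
    when [delta] is half of the gap [gamma - sqrt pbar]. *)
Lemma layer_p_derivatives_bounded (gamma pbar : R) (L : layer) :
  0 < gamma -> 0 < pbar < gamma ^ 2 -> layer_facts gamma pbar L ->
  exists M, 0 <= M /\ forall s p xi, small pbar p -> 0 <= xi ->
    Rabs (Derive_on (small pbar) (v0t L xi s) p) <= M /\
    Rabs (Derive_on (small pbar)
            (fun p' => Derive (fun y => v0t L xi y p') s) p) <= M.
Proof.
intros Hg Hp HL.
assert (Hs : sqrt pbar < gamma).
{ rewrite <- (sqrt_pow2 gamma) by lra. apply sqrt_lt_1; lra. }
destruct (layer_decay _ _ _ HL 0%nat ((gamma - sqrt pbar) / 2) ltac:(lra))
  as [C HC].
exists (Rmax C 0). split; [apply Rmax_r|].
intros s p xi Hpp Hxi. specialize (HC s p xi Hpp Hxi).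
assert (Hsp : sqrt (Rabs p) <= sqrt pbar) by (apply sqrt_le_1_alt; exact Hpp).
set (E := exp _) in HC.
assert (HE : 0 < E <= 1).
{ unfold E. split; [apply exp_pos|]. rewrite <- exp_0.
  set (X := - _ * xi). assert (HX : X <= 0) by (unfold X; nra).
  destruct HX as [HX|HX]; [left; apply exp_increasing; exact HX|].
  rewrite HX. lra. }
assert (HCM : C * E <= Rmax C 0).
{ generalize (Rmax_l C 0) (Rmax_r C 0). intros. nra. }
assert (Hsum : forall a1 a2 a3 a4 a5 a6,
  Rabs a1 + Rabs a2 + Rabs a3 + Rabs a4 + Rabs a5 + Rabs a6 <= C * E ->
  Rabs a5 <= Rmax C 0 /\ Rabs a6 <= Rmax C 0).
{ intros a1 a2 a3 a4 a5 a6 H.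
  generalize (Rabs_pos a1) (Rabs_pos a2) (Rabs_pos a3) (Rabs_pos a4)
    (Rabs_pos a5) (Rabs_pos a6). lra. }
exact (Hsum _ _ _ _ _ _ HC).
Qed.

Lemma layer_increasing (gamma pbar : R) (L : layer) :
  0 < pbar -> layer_facts gamma pbar L ->
  forall xi s p p', 0 <= xi -> small pbar p -> small pbar p' -> p <= p' ->
  v0t L xi s p <= v0t L xi s p'.
Proof.
intros Hpb HL xi s p p' Hxi Hp Hp' Hle.
destruct (MVT_small pbar (v0t L xi s) Hpb) with (p := p) (p' := p')
  as [c [Hc E]]; [|assumption..|].
- intros r Hr. apply (layer_ex _ _ _ HL 0%nat s r xi Hr Hxi).
- generalize (layer_p_nonneg _ _ _ HL s c xi Hc Hxi). nra.
Qed.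

Lemma layer_lipschitz (gamma pbar : R) (L : layer) :
  0 < gamma -> 0 < pbar < gamma ^ 2 -> layer_facts gamma pbar L ->
  exists M, forall xi s p p', 0 <= xi -> small pbar p -> small pbar p' ->
  Rabs (v0t L xi s p' - v0t L xi s p) <= M * Rabs (p' - p).
Proof.
intros Hg Hpb HL.
destruct (layer_p_derivatives_bounded gamma pbar L Hg Hpb HL) as [M [_ HM]].
exists M. intros xi s p p' Hxi Hp Hp'.
apply (lipschitz_small pbar); try assumption; [lra| |].
- intros r Hr. apply (layer_ex _ _ _ HL 0%nat s r xi Hr Hxi).
- intros r Hr. exact (proj1 (HM s r xi Hr Hxi)).
Qed.

(** The bound on the mixed derivative, integrated in [p] and then in [s]: a
    rectangle increment is at most a constant times the product of its
    sides. *)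
Lemma layer_mixed_lipschitz (gamma pbar : R) (L : layer) :
  0 < gamma -> 0 < pbar < gamma ^ 2 -> layer_facts gamma pbar L ->
  exists M, 0 <= M /\
  forall xi s p p', 0 <= xi -> small pbar p -> small pbar p' ->
  Rabs ((v0t L xi s p' - v0t L xi s p) - (v0t L xi 0 p' - v0t L xi 0 p))
    <= M * Rabs s * Rabs (p' - p).
Proof.
intros Hg Hpb HL.
destruct (layer_p_derivatives_bounded gamma pbar L Hg Hpb HL) as [M [M0 HM]].
exists M. split; [exact M0|]. intros xi s p p' Hxi Hp Hp'.
assert (Hs : forall r t, small pbar r ->
  is_derive (fun y => v0t L xi y r) t (Derive (fun y => v0t L xi y r) t)).
{ intros r t Hr. apply Derive_correct.
  exact (proj1 (proj2 (layer_ex _ _ _ HL 1%nat t r xi Hr Hxi))). }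
set (F := fun y => v0t L xi y p' - v0t L xi y p).
set (dF := fun t => Derive (fun y => v0t L xi y p') t
                    - Derive (fun y => v0t L xi y p) t).
assert (HF : forall t, is_derive F t (dF t)).
{ intros t. apply (is_derive_minus (fun y => v0t L xi y p')); auto. }
destruct (MVT_gen F 0 s dF) as [c [_ E]].
- intros t _. apply HF.
- intros t _. apply continuity_pt_filterlim.
  apply (ex_derive_continuous F). exists (dF t). apply HF.
- change (Rabs (F s - F 0) <= M * Rabs s * Rabs (p' - p)).
  rewrite E, Rabs_mult, Rminus_0_r.
  replace (M * Rabs s * Rabs (p' - p))
    with (M * Rabs (p' - p) * Rabs s) by ring.
  apply Rmult_le_compat_r; [apply Rabs_pos|].
  apply (lipschitz_small pbar M
    (fun r => Derive (fun y => v0t L xi y r) c)); try assumption; [lra| |].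
  + intros r Hr. apply (layer_ex _ _ _ HL 0%nat c r xi Hr Hxi).
  + intros r Hr. exact (proj2 (HM c r xi Hr Hxi)).
Qed.

(** * The corner function *)

Lemma corner_lipschitz (u0 g : plane -> R) (pbar : R) (G Gm : side)
  (L Lm : layer) (Z : corner) :
  0 < pbar -> corner_facts u0 g pbar G Gm L Lm Z ->
  exists C1 c1, 0 < C1 /\ 0 < c1 /\
  forall eta p p', sector G Gm eta -> small pbar p -> small pbar p' ->
  Rabs (q0t G Gm L Lm Z eta p' - q0t G Gm L Lm Z eta p)
    <= C1 * exp (- c1 * norm eta) * Rabs (p' - p).
Proof.
intros Hpb HZ.
destruct (q_decay _ _ _ _ _ _ _ _ HZ) as [C1 [c1 [HC1 [Hc1 HD]]]].
exists C1, c1. split; [exact HC1|]. split; [exact Hc1|].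
intros eta p p' He Hp Hp'.
apply (lipschitz_small pbar); try assumption.
- intros r Hr. apply (q0t_ex _ _ _ _ _ _ _ _ HZ eta r He Hr).
- intros r Hr. eapply Rle_trans; [|exact (HD eta r He Hr)].
  generalize (Rabs_pos (q0t G Gm L Lm Z eta r))
    (Rabs_pos (q1 G Gm L Lm Z eta)). lra.
Qed.

Lemma corner_far_from_vertex (u0 g : plane -> R) (pbar : R) (G Gm : side)
  (L Lm : layer) (Z : corner) (kappa : R) :
  0 < pbar -> corner_facts u0 g pbar G Gm L Lm Z -> 0 < kappa ->
  exists K, 0 < K /\
  forall eta p p', sector G Gm eta -> K <= norm eta ->
  small pbar p -> small pbar p' -> p <= p' ->
  - kappa * (p' - p) <= q0t G Gm L Lm Z eta p' - q0t G Gm L Lm Z eta p.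
Proof.
intros Hpb HZ Hk.
destruct (corner_lipschitz _ _ _ _ _ _ _ _ Hpb HZ)
  as [C1 [c1 [HC1 [Hc1 HD]]]].
(* From [c1 * K < exp (c1 * K)]: this radius gives
   [C1 * exp (- c1 * K) < kappa]. *)
exists (C1 / kappa / c1).
assert (HK : 0 < C1 / kappa / c1).
{ repeat apply Rdiv_lt_0_compat; assumption. }
split; [exact HK|]. intros eta p p' He HKe Hp Hp' Hle.
specialize (HD eta p p' He Hp Hp').
rewrite (Rabs_pos_eq (p' - p)) in HD by lra.
assert (Hdec : C1 * exp (- c1 * norm eta) <= kappa).
{ assert (H1 : C1 / kappa <= c1 * norm eta).
  { replace (C1 / kappa) with (c1 * (C1 / kappa / c1)) by (field; lra).
    apply Rmult_le_compat_l; lra. }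
  assert (H0 : 0 < C1 / kappa) by (apply Rdiv_lt_0_compat; assumption).
  assert (H2 := exp_ineq1 (c1 * norm eta) ltac:(lra)).
  assert (H3 : C1 <= kappa * exp (c1 * norm eta)).
  { replace C1 with (kappa * (C1 / kappa)) by (field; lra).
    apply Rmult_le_compat_l; lra. }
  replace (- c1 * norm eta) with (- (c1 * norm eta)) by ring.
  rewrite exp_Ropp. assert (H4 := exp_pos (c1 * norm eta)).
  apply (Rmult_le_reg_r (exp (c1 * norm eta))); [exact H4|].
  rewrite Rmult_assoc, Rinv_l by lra. lra. }
apply Rabs_le_between in HD. nra.
Qed.

(** The monotonicity of [z0t] bounds a decrease of [q0t] by the increase of the
    two layer functions that are subtracted in it. *)
Lemma corner_near_vertex (u0 g : plane -> R) (pbar : R) (G Gm : side)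
  (L Lm : layer) (Z : corner) :
  corner_facts u0 g pbar G Gm L Lm Z ->
  forall eta p p', sector G Gm eta ->
  small pbar p -> small pbar p' -> p <= p' ->
  - (v0t L (dot eta (e_r G)) 0 p' - v0t L (dot eta (e_r G)) 0 p)
  - (v0t Lm (dot eta (e_r Gm)) 0 p' - v0t Lm (dot eta (e_r Gm)) 0 p)
    <= q0t G Gm L Lm Z eta p' - q0t G Gm L Lm Z eta p.
Proof.
intros HZ eta p p' He Hp Hp' Hle.
generalize (z0t_incr _ _ _ _ _ _ _ _ HZ eta p p' He Hp Hp' Hle).
unfold q0t. lra.
Qed.

(** * Coordinates in the sector *)

Lemma sector_scal (G Gm : side) (k : R) (x : plane) :
  0 < k -> sector G Gm x -> sector G Gm (scal k x).
Proof.
intros Hk [a [c [Ha [Hc ->]]]].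
exists (k * a), (k * c).
split; [nra|]. split; [nra|].
transitivity (plus (scal k (on_side G a)) (scal k (on_side Gm c))).
- apply (@scal_distr_l R_Ring plane).
- unfold on_side. f_equal; apply (@scal_assoc R_Ring plane).
Qed.

Lemma sector_sym (G Gm : side) (x : plane) : sector G Gm x -> sector Gm G x.
Proof.
intros [a [c [Ha [Hc ->]]]]. exists c, a.
split; [exact Hc|]. split; [exact Ha|]. apply plus_comm.
Qed.

Lemma dot_scal (k : R) (x y : plane) : dot (scal k x) y = k * dot x y.
Proof.
unfold dot, scal; simpl. unfold prod_scal; simpl.
unfold scal; simpl. unfold mult; simpl. ring.
Qed.

Lemma norm_plane_sq (x : plane) :
  fst x * fst x + snd x * snd x = norm x * norm x.
Proof.
unfold norm at 1 2; simpl. unfold prod_norm, norm; simpl.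
unfold abs; simpl. rewrite !Rmult_1_r, <- !Rabs_mult.
rewrite sqrt_sqrt; [rewrite !Rabs_pos_eq by apply Rle_0_sqr; reflexivity|].
apply Rplus_le_le_0_compat; apply Rabs_pos.
Qed.

Lemma dot_unit_le (x e : plane) : norm e = 1 -> Rabs (dot x e) <= norm x.
Proof.
intros He.
assert (H := norm_plane_sq x). assert (H' := norm_plane_sq e).
rewrite He in H'.
assert (Hn : 0 <= norm x) by apply norm_ge_0.
rewrite <- (Rabs_pos_eq (norm x) Hn). apply Rsqr_le_abs_0.
unfold Rsqr. rewrite <- H. unfold dot.
(* Lagrange's identity: the difference of the two sides is this square. *)
assert (H2 := Rle_0_sqr (fst x * snd e - snd x * fst e)). unfold Rsqr in H2.
replace (fst x * fst x + snd x * snd x)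
  with ((fst x * fst x + snd x * snd x) * (fst e * fst e + snd e * snd e))
  by (rewrite H'; ring).
lra.
Qed.

Lemma frame_normal_nonneg (G Gm : side) (x : plane) (eps : R) :
  is_frame G Gm -> 0 < eps -> sector G Gm x -> 0 <= dot x (e_r G) / eps.
Proof.
intros HF He Hx. left. apply Rdiv_lt_0_compat; [|exact He].
apply (frame_in _ _ HF x Hx).
Qed.

Lemma frame_tangential_le (G Gm : side) (x : plane) (eps : R) :
  is_frame G Gm -> 0 < eps ->
  Rabs (dot x (e_s G)) <= eps * norm (scal (/ eps) x).
Proof.
intros HF He.
replace (dot x (e_s G)) with (eps * dot (scal (/ eps) x) (e_s G))
  by (rewrite dot_scal; field; lra).
rewrite Rabs_mult, (Rabs_pos_eq eps) by lra.
apply Rmult_le_compat_l; [lra|]. apply dot_unit_le, (frame_s _ _ HF).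
Qed.

(** * The parametrised expansion *)

Lemma beta_0 (u0 : plane -> R) (G Gm : side) (L Lm : layer) (Z : corner)
  (theta eps : R) (x : plane) :
  beta u0 G Gm L Lm Z theta eps x 0 = u_as u0 G Gm L Lm Z eps x.
Proof.
unfold beta, u_as, vt, v, v0, qt, q. ring.
Qed.

Lemma beta_increment (u0 : plane -> R) (G Gm : side) (L Lm : layer)
  (Z : corner) (theta eps : R) (x : plane) (p p' : R) :
  beta u0 G Gm L Lm Z theta eps x p' - beta u0 G Gm L Lm Z theta eps x p =
  (v0t L (dot x (e_r G) / eps) (dot x (e_s G)) p'
   - v0t L (dot x (e_r G) / eps) (dot x (e_s G)) p)
  + (v0t Lm (dot x (e_r Gm) / eps) (dot x (e_s Gm)) p'
     - v0t Lm (dot x (e_r Gm) / eps) (dot x (e_s Gm)) p)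
  + (q0t G Gm L Lm Z (scal (/ eps) x) p' - q0t G Gm L Lm Z (scal (/ eps) x) p)
  + theta * (p' - p).
Proof.
unfold beta, vt, qt. ring.
Qed.

Lemma beta_lipschitz (u0 g : plane -> R) (gamma pbar theta : R)
  (G Gm : side) (L Lm : layer) (Z : corner) :
  is_frame G Gm -> is_frame Gm G -> 0 < gamma -> 0 < pbar < gamma ^ 2 ->
  layer_facts gamma pbar L -> layer_facts gamma pbar Lm ->
  corner_facts u0 g pbar G Gm L Lm Z -> 0 < theta ->
  exists C, forall eps x p p', 0 < eps -> sector G Gm x ->
  small pbar p -> small pbar p' ->
  Rabs (beta u0 G Gm L Lm Z theta eps x p'
        - beta u0 G Gm L Lm Z theta eps x p) <= C * Rabs (p' - p).
Proof.
intros HF HFm Hg Hpb HL HLm HZ Hth.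
destruct (layer_lipschitz gamma pbar L Hg Hpb HL) as [M HM].
destruct (layer_lipschitz gamma pbar Lm Hg Hpb HLm) as [Mm HMm].
destruct (corner_lipschitz _ _ _ _ _ _ _ _ (proj1 Hpb) HZ)
  as [C1 [c1 [HC1 [Hc1 HD]]]].
exists (M + Mm + C1 + theta). intros eps x p p' He Hx Hp Hp'.
rewrite beta_increment.
specialize (HM _ (dot x (e_s G)) p p'
  (frame_normal_nonneg G Gm x eps HF He Hx) Hp Hp').
specialize (HMm _ (dot x (e_s Gm)) p p'
  (frame_normal_nonneg Gm G x eps HFm He (sector_sym _ _ _ Hx)) Hp Hp').
assert (Heta : sector G Gm (scal (/ eps) x))
  by (apply sector_scal; [apply Rinv_0_lt_compat|]; assumption).
specialize (HD _ p p' Heta Hp Hp').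
assert (HE : exp (- c1 * norm (scal (/ eps) x)) <= 1).
{ rewrite <- exp_0. assert (Hn := norm_ge_0 (scal (/ eps) x)).
  set (X := - c1 * _). assert (HX : X <= 0) by (unfold X; nra).
  destruct HX as [HX| ->]; [left; apply exp_increasing; exact HX|lra]. }
assert (Ht : Rabs (theta * (p' - p)) = theta * Rabs (p' - p))
  by (rewrite Rabs_mult, (Rabs_pos_eq theta); lra).
assert (HD' : C1 * exp (- c1 * norm (scal (/ eps) x)) * Rabs (p' - p)
  <= C1 * Rabs (p' - p)).
{ apply Rmult_le_compat_r; [apply Rabs_pos|].
  rewrite <- (Rmult_1_r C1) at 2. apply Rmult_le_compat_l; lra. }
do 3 (eapply Rle_trans; [apply Rabs_triang|];
      rewrite ?Rmult_plus_distr_r; apply Rplus_le_compat; [|lra]).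
exact HM.
Qed.

(** The threshold for [eps] is chosen after the radius [K], so that the two
    rectangle increments near the vertex cost at most [theta / 2]. *)
Lemma beta_increase (u0 g : plane -> R) (gamma pbar theta : R)
  (G Gm : side) (L Lm : layer) (Z : corner) :
  is_frame G Gm -> is_frame Gm G -> 0 < gamma -> 0 < pbar < gamma ^ 2 ->
  layer_facts gamma pbar L -> layer_facts gamma pbar Lm ->
  corner_facts u0 g pbar G Gm L Lm Z -> 0 < theta ->
  exists eps0, 0 < eps0 /\
  forall eps x p p', 0 < eps <= eps0 -> sector G Gm x ->
  small pbar p -> small pbar p' -> p <= p' ->
  / 2 * theta * (p' - p) <=
  beta u0 G Gm L Lm Z theta eps x p' - beta u0 G Gm L Lm Z theta eps x p.
Proof.
intros HF HFm Hg Hpb HL HLm HZ Hth.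
destruct (layer_mixed_lipschitz gamma pbar L Hg Hpb HL) as [M [M0 HM]].
destruct (layer_mixed_lipschitz gamma pbar Lm Hg Hpb HLm) as [Mm [Mm0 HMm]].
destruct (corner_far_from_vertex _ _ _ _ _ _ _ _ (/ 2 * theta)
  (proj1 Hpb) HZ ltac:(lra)) as [K [HK Hfar]].
assert (HA : 0 < (M + Mm + 1) * K) by nra.
exists (/ 2 * theta / ((M + Mm + 1) * K)).
split; [apply Rdiv_lt_0_compat; lra|].
intros eps x p p' [He He0] Hx Hp Hp' Hle.
rewrite beta_increment.
assert (Hxi := frame_normal_nonneg G Gm x eps HF He Hx).
assert (Hxim :=
  frame_normal_nonneg Gm G x eps HFm He (sector_sym _ _ _ Hx)).
assert (Heta : sector G Gm (scal (/ eps) x))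
  by (apply sector_scal; [apply Rinv_0_lt_compat|]; assumption).
destruct (Rle_dec K (norm (scal (/ eps) x))) as [Hn|Hn].
- specialize (Hfar _ p p' Heta Hn Hp Hp' Hle).
  assert (H1 := layer_increasing gamma pbar L (proj1 Hpb) HL
    _ (dot x (e_s G)) p p' Hxi Hp Hp' Hle).
  assert (H2 := layer_increasing gamma pbar Lm (proj1 Hpb) HLm
    _ (dot x (e_s Gm)) p p' Hxim Hp Hp' Hle).
  lra.
- assert (Hnear := corner_near_vertex _ _ _ _ _ _ _ _ HZ
    _ p p' Heta Hp Hp' Hle).
  rewrite !dot_scal, !(Rmult_comm (/ eps)) in Hnear.
  fold (dot x (e_r G) / eps) (dot x (e_r Gm) / eps) in Hnear.
  specialize (HM _ (dot x (e_s G)) p p' Hxi Hp Hp').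
  specialize (HMm _ (dot x (e_s Gm)) p p' Hxim Hp Hp').
  assert (Hs := frame_tangential_le G Gm x eps HF He).
  assert (Hsm := frame_tangential_le Gm G x eps HFm He).
  rewrite (Rabs_pos_eq (p' - p)) in HM, HMm by lra.
  assert (HeK : eps * norm (scal (/ eps) x) <= eps * K)
    by (apply Rmult_le_compat_l; lra).
  assert (HB : M * Rabs (dot x (e_s G)) + Mm * Rabs (dot x (e_s Gm))
    <= / 2 * theta).
  { apply (Rmult_le_compat_r ((M + Mm + 1) * K)) in He0; [|lra].
    replace (/ 2 * theta / ((M + Mm + 1) * K) * ((M + Mm + 1) * K))
      with (/ 2 * theta) in He0 by (field; split; nra).
    assert (M * Rabs (dot x (e_s G)) <= M * (eps * K))
      by (apply Rmult_le_compat_l; lra).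
    assert (Mm * Rabs (dot x (e_s Gm)) <= Mm * (eps * K))
      by (apply Rmult_le_compat_l; lra).
    assert (0 < eps * K) by nra. lra. }
  apply (Rmult_le_compat_r (p' - p)) in HB; [|lra].
  apply Rabs_le_between in HM, HMm. lra.
Qed.

Theorem lemma4p1
  (b : plane -> R -> R) (u0 g : plane -> R) (gamma pbar theta : R)
  (G Gm : side) (L Lm : layer) (Z : corner)
  (HS : is_sector G Gm)
  (Hdata : problem_data b u0 g gamma G Gm)
  (Hpbar : 0 < pbar < gamma ^ 2)
  (HL : layer_problem b u0 pbar G L)
  (HLm : layer_problem b u0 pbar Gm Lm)
  (HZ : corner_problem b u0 g pbar G Gm Z)
  (HLfacts : layer_facts gamma pbar L)
  (HLmfacts : layer_facts gamma pbar Lm)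
  (HZfacts : corner_facts u0 g pbar G Gm L Lm Z)
  (Htheta : 0 < theta) :
  (exists C : R, forall (eps p : R) (x : plane),
      0 < eps -> Rabs p <= pbar -> sector G Gm x ->
      Rabs (beta u0 G Gm L Lm Z theta eps x p - u_as u0 G Gm L Lm Z eps x)
      <= C * Rabs p) /\
  (exists eps0 : R, 0 < eps0 /\
    forall (p eps : R) (x : plane),
      0 <= p <= pbar -> 0 < eps <= eps0 -> sector G Gm x ->
      beta u0 G Gm L Lm Z theta eps x (- p)
        <= u_as u0 G Gm L Lm Z eps x - / 2 * theta * p /\
      u_as u0 G Gm L Lm Z eps x + / 2 * theta * p
        <= beta u0 G Gm L Lm Z theta eps x p).
Proof.
destruct HS as [HF HFm _].
assert (Hg : 0 < gamma) by apply (A1_gamma _ _ _ _ _ _ Hdata).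
assert (S0 : small pbar 0) by (unfold small; rewrite Rabs_R0; lra).
split.
- destruct (beta_lipschitz u0 g gamma pbar theta G Gm L Lm Z) as [C HC];
    try assumption.
  exists C. intros eps p x He Hp Hx.
  rewrite <- (beta_0 u0 G Gm L Lm Z theta eps x).
  rewrite <- (Rminus_0_r p) at 2. apply HC; assumption.
- destruct (beta_increase u0 g gamma pbar theta G Gm L Lm Z)
    as [eps0 [He0 HI]]; try assumption.
  exists eps0. split; [exact He0|]. intros p eps x Hp He Hx.
  rewrite <- (beta_0 u0 G Gm L Lm Z theta eps x).
  assert (Sp : small pbar p) by (apply Rabs_le; lra).
  assert (Sm : small pbar (- p)) by (apply Rabs_le; lra).
  assert (H1 := HI eps x (- p) 0 He Hx Sm S0 ltac:(lra)).
  assert (H2 := HI eps x 0 p He Hx S0 Sp ltac:(lra)).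
  lra.
Qed.
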